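(* Let $(V, \|\cdot\|_V)$ be a normed vector space over $\mathbb{K}$ ($\mathbb{K}=\mathbb{R}$ or $\mathbb{K}=\mathbb{C}$), let $S \subset V$ be a subset, and let $n\in\mathbb{N}$, $p \in \mathbb{N}_0$. Then the polynomial manifold $(n,p)$-width is bounded from below by $$d_{t(n,p)}(S;V) \;\leq\; d^{\otimes}_{n,p}(S;V)\;\leq\; \delta^{\otimes}_{n,p}(S;V).$$
   Context: Here $\mathbb{N}=\{1,2,\dots\}$ and $\mathbb{N}_0=\mathbb{N}\cup\{0\}$. All distances and widths take values in $[0,\infty]$. For $n\in\mathbb{N}$, $k\in\mathbb{N}_0$ put $m(n,k):=\binom{n+k-1}{k}$, and for $p\in\mathbb{N}_0$ put $t(n,p):=\sum_{k=0}^{p} m(n,k)$. For $\check{x}=(\check x_1,\dots,\check x_n)\in\mathbb{K}^n$, the symmetric Kronecker product of order $k\ge 0$, written $\check{x}^{\otimes^{\mathrm s} k}\in\mathbb{K}^{m(n,k)}$, is the vector listing (in some fixed order) all monomials of degree exactly $k$ in $\check x_1,\dots,\check x_n$, each once; for $k=0$ it is $1\in\mathbb{K}$. Polynomial mapping of degree $p\in\mathbb{N}_0$: given vectors $v_{kj}\in V$ ($0\le k\le p$, $1\le j\le m(n,k)$), it is the map $$\Gamma_{n,p}:\mathbb{K}^n\to V,\qquad \check{x}\mapsto \sum_{k=0}^{p}\sum_{j=1}^{m(n,k)} \bigl(\check{x}^{\otimes^{\mathrm s} k}\bigr)_j\, v_{kj}.$$ Its image $\widetilde{\mathcal M}_{n,p}:=\operatorname{img}(\Gamma_{n,p})\subset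 V$ is called a polynomially mapped submanifold. For sets $S,T\subseteq V$, $\operatorname{dist}(S,T):=\sup_{s\in S}\inf_{t\in T}\|s-t\|_V$. Classical Kolmogorov $n$-width: $d_n(S;V):=\inf\{\operatorname{dist}(S,U): U\subseteq V \text{ linear subspace},\ \dim U\le n\}$. Polynomial Kolmogorov $(n,p)$-width: $d^{\otimes}_{n,p}(S;V):=\inf \operatorname{dist}(S,\widetilde{\mathcal M}_{l,p})$, where the infimum is over all $l\in\mathbb{N}$ with $l\le n$ and all polynomially mapped submanifolds $\widetilde{\mathcal M}_{l,p}=\operatorname{img}(\Gamma_{l,p})$ of polynomial mappings $\Gamma_{l,p}:\mathbb{K}^l\to V$ of degree $p$ (all choices of the vectors $v_{kj}$). Polynomial manifold $(n,p)$-width: $$\delta^{\otimes}_{n,p}(S;V):=\inf_{\Gamma_{l,p},\ l\le n}\ \inf_{e\in C^0(V,\mathbb{K}^l)}\ \sup_{s\in S}\|s-\Gamma_{l,p}(e(s))\|_V,$$ where the first infimum is over all $l\in\mathbb{N}$ with $l\le n$ and all polynomial mappings $\Gamma_{l,p}:\mathbb{K}^l\to V$ of degree $p$, and $C^0(V,\mathbb{K}^l)$ is the set of continuous maps (''encoders'') $V\to\mathbb{K}^l$. *)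

(* Defs.v *)
From HB Require Import structures.
From mathcomp Require Import all_boot all_order all_algebra.
From mathcomp Require Import complex.
From mathcomp Require Import all_classical all_reals all_analysis.
Set Implicit Arguments.
Unset Strict Implicit.
Unset Printing Implicit Defensive.
Import Order.TTheory GRing.Theory Num.Theory.
Import numFieldNormedType.Exports.
Local Open Scope classical_set_scope.
Local Open Scope ring_scope.

(* The number of monomials of degree exactly [k] in [n] variables; the
   truncated [n + k - 1] is the intended number for [0 < n]. *)
Definition nmonom (n k : nat) : nat := 'C(n + k - 1, k).

Definition nmonom_upto (n p : nat) : nat := (\sum_(k < p.+1) nmonom n k)%N.

(* Exponents of a degree [k] monomial are at most [k], hence ['I_k.+1]. *)
Definition exponents (n k : nat) : seq (n.-tuple 'I_k.+1) :=
  enum [set t : n.-tuple 'I_k.+1 | (\sum_(i <- t) i == k)%N]%SET.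

Lemma size_exponents (n k : nat) :
  (0 < n)%N -> size (exponents n k) = nmonom n k.
Proof.
case: n => // n _; rewrite /exponents -cardE card_ord_partitions /nmonom.
by rewrite addSn subn1 /= -[in RHS]bin_sub ?leq_addl// addnK.
Qed.

Definition symkron (K : pzRingType) (n k : nat) (x : 'rV[K]_n) :
    'rV[K]_(nmonom n k) :=
  \row_j \prod_(i < n)
    x 0 i ^+ tnth (nth [tuple ord0 | _ < n] (exponents n k) j) i.

Section PolynomialMapping.
Context {K : pzRingType} {V : lmodType K}.

Definition polymap (n p : nat) (v : forall k : 'I_p.+1, 'I_(nmonom n k) -> V)
    (x : 'rV[K]_n) : V :=
  \sum_(k < p.+1) \sum_(j < nmonom n k) symkron k x 0 j *: v k j.

Definition polynomial_mapping (n p : nat) (G : 'rV[K]_n -> V) : Prop :=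
  exists v : forall k : 'I_p.+1, 'I_(nmonom n k) -> V, G = polymap v.

Definition polynomially_mapped_submanifold (n p : nat) (M : set V) : Prop :=
  exists2 G : 'rV[K]_n -> V, polynomial_mapping p G & M = range G.

Definition linear_subspace (U : set V) : Prop :=
  U 0 /\ forall (a : K) (u v : V), U u -> U v -> U (a *: u + v).

Definition linearly_independent (d : nat) (b : 'I_d -> V) : Prop :=
  forall c : 'I_d -> K, \sum_(i < d) c i *: b i = 0 -> forall i, c i = 0.

Definition basis (U : set V) (d : nat) (b : 'I_d -> V) : Prop :=
  linearly_independent b /\
  U = [set \sum_(i < d) c i *: b i | c in [set: 'I_d -> K]].

Definition dim_le (U : set V) (n : nat) : Prop :=
  exists2 d : nat, (d <= n)%N & exists b : 'I_d -> V, basis U b.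

End PolynomialMapping.

Variant scalar_kind := RealScalars | ComplexScalars.

Definition scalars (R : realType) (kind : scalar_kind) : numFieldType :=
  match kind with RealScalars => R | ComplexScalars => R[i] end.

Definition real_part (R : realType) (kind : scalar_kind) :
    scalars R kind -> R :=
  match kind return scalars R kind -> R with
  | RealScalars => fun x => x
  | ComplexScalars => fun z => complex.Re z
  end.

(* Supremum in [0, +oo]: the supremum of the empty set is [0], not [-oo].
   For infima, [ereal_inf set0 = +oo] is already the right value. *)
Definition sup_nneg (R : realType) (A : set (\bar R)) : \bar R :=
  maxe 0%E (ereal_sup A).

Section Widths.
Context {R : realType} {kind : scalar_kind}
  {V : normedModType (scalars R kind)}.
Local Notation K := (scalars R kind).

(* The norm of a [normedModType K] is [K]-valued; it is a nonnegative element
   of [K], hence real, so that taking its real part loses nothing. *)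
Definition enorm (v : V) : \bar R := (real_part `|v|)%:E.

Definition dist (S T : set V) : \bar R :=
  sup_nneg [set ereal_inf [set enorm (s - t) | t in T] | s in S].

Definition kolmogorov_width (n : nat) (S : set V) : \bar R :=
  ereal_inf [set dist S U | U in
    [set U : set V | linear_subspace U /\ dim_le U n]].

Definition poly_kolmogorov_width (n p : nat) (S : set V) : \bar R :=
  ereal_inf [set dist S M | M in
    [set M : set V | exists2 l : nat, (0 < l <= n)%N &
                       polynomially_mapped_submanifold l p M]].

Definition encoding_error (l : nat) (S : set V) (G : 'rV[K]_l -> V)
    (e : V -> 'rV[K]_l) : \bar R :=
  sup_nneg [set enorm (s - G (e s)) | s in S].

Definition poly_manifold_width (n p : nat) (S : set V) : \bar R :=
  ereal_inf [set w | exists l : nat, (0 < l <= n)%N /\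
    exists2 G : 'rV[K]_l -> V, polynomial_mapping p G &
      w = ereal_inf [set encoding_error S G e | e in
            [set e : V -> 'rV[K]_l | continuous e]]].

End Widths.

(* Main.v *)
(* A polynomial mapping takes values in the span of its t(l,p) coefficient
   vectors, so its image lies in a subspace of dimension at most
   t(l,p) <= t(n,p), and enlarging the approximating set only decreases the
   distance. For any encoder e, G (e s) is one particular point of the image
   of G, so the encoding error dominates the distance to that image. *)
Require Import Defs.
From HB Require Import structures.
From mathcomp Require Import all_boot all_order all_algebra.
From mathcomp Require Import complex.
From mathcomp Require Import all_classical all_reals all_analysis.
Set Implicit Arguments.
Unset Strict Implicit.
Unset Printing Implicit Defensive.
Import Order.TTheory GRing.Theory Num.Theory.
Import numFieldNormedType.Exports.
Local Open Scope classical_set_scope.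
Local Open Scope ring_scope.

Section LinearSpan.
Context {K : fieldType} {V : lmodType K}.

(** The index type is an arbitrary [finType], so that families indexed by dependent pairs are
    covered; [f] may be linearly dependent. *)
Definition lin_span (I : finType) (f : I -> V) : set V :=
  [set \sum_i c i *: f i | c in [set: I -> K]].

Lemma linear_subspace_lin_span (I : finType) (f : I -> V) :
  linear_subspace (lin_span f).
Proof.
split.
  by exists (fun=> 0) => //; rewrite big1// => i _; rewrite scale0r.
move=> a _ _ [c _ <-] [d _ <-].
exists (fun i => a * c i + d i) => //.
rewrite scaler_sumr -big_split/=; apply: eq_bigr => i _.
by rewrite scalerDl scalerA.
Qed.

Lemma lin_span_reindex (I J : finType) (h : J -> I) (f : I -> V) :
  bijective h -> lin_span (f \o h) = lin_span f.
Proof.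
move=> hbij; have [g hK gK] := hbij.
apply/seteqP; split=> _ [c _ <-].
  exists (c \o g) => //; rewrite (reindex h) /=; last exact: onW_bij.
  by apply: eq_bigr => j _; rewrite hK.
exists (c \o h) => //; rewrite [RHS](reindex h) //; exact: onW_bij.
Qed.

Lemma dim_leW (U : set V) (m n : nat) : (m <= n)%N -> dim_le U m -> dim_le U n.
Proof. by move=> mn [d dm bU]; exists d => //; exact: leq_trans mn. Qed.

(** Since [c i0] is invertible, the relation expresses [f i0] through the other vectors, so [f i0]
    is redundant. *)
Lemma lin_span_drop (m : nat) (f : 'I_m.+1 -> V) (c : 'I_m.+1 -> K)
    (i0 : 'I_m.+1) :
  \sum_i c i *: f i = 0 -> c i0 != 0 -> lin_span (f \o lift i0) = lin_span f.
Proof.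
move=> c0 ci0; apply/seteqP; split=> _ [a _ <-].
  exists (fun i => if unlift i0 i is Some j then a j else 0) => //.
  rewrite (bigD1_ord i0)//= unlift_none scale0r add0r.
  by apply: eq_bigr => j _; rewrite liftK.
(* Subtracting [a i0 / c i0] times the vanishing relation keeps the sum and makes the coefficient at
   [i0] zero. *)
exists (fun j => a (lift i0 j) - a i0 / c i0 * c (lift i0 j)) => //.
have -> : \sum_i a i *: f i = \sum_i (a i - a i0 / c i0 * c i) *: f i.
  under [RHS]eq_bigr do rewrite scalerBl -scalerA.
  by rewrite sumrB -scaler_sumr c0 scaler0 subr0.
by rewrite [RHS](bigD1_ord i0)//= divfK// subrr scale0r add0r.
Qed.

(** [dim_le] asks for an actual basis: either [f] is independent and serves itself, or a redundant
    vector is dropped and the induction hypothesis applies. *)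
Lemma dim_le_lin_span_ord (m : nat) (f : 'I_m -> V) : dim_le (lin_span f) m.
Proof.
elim: m f => [|m IH] f; first by exists 0%N => //; exists f; split=> // c _ [].
have [fli|/existsNP[c /not_implyP[c0 /existsNP[i0 /eqP ci0]]]] :=
  pselect (linearly_independent f); first by exists m.+1 => //; exists f.
by rewrite -(lin_span_drop c0 ci0); apply: dim_leW (IH _).
Qed.

Lemma dim_le_lin_span (I : finType) (f : I -> V) : dim_le (lin_span f) #|I|.
Proof.
rewrite -(lin_span_reindex f (@enum_val_bij I)).
exact: dim_le_lin_span_ord.
Qed.

Lemma submanifold_sub_subspace (l p : nat) (M : set V) :
  polynomially_mapped_submanifold l p M ->
  exists U : set V,
    [/\ linear_subspace U, dim_le U (nmonom_upto l p) & M `<=` U].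
Proof.
move=> [_ [v ->] ->].
(* The range of [j] depends on [k], so the coefficient vectors are flattened into one family over
   dependent pairs; these number exactly t(l,p). *)
pose f (kj : {k : 'I_p.+1 & 'I_(nmonom l k)}) := v (tag kj) (tagged kj).
exists (lin_span f); split; first exact: linear_subspace_lin_span.
  have -> : nmonom_upto l p = #|{: {k : 'I_p.+1 & 'I_(nmonom l k)}}|.
    rewrite card_tagged sumnE big_map big_enum /=.
    by apply: eq_bigr => k _; rewrite card_ord.
  exact: dim_le_lin_span.
move=> _ [x _ <-].
exists (fun kj : {k : 'I_p.+1 & 'I_(nmonom l k)} =>
  symkron (tag kj) x 0 (tagged kj)) => //.
by rewrite /polymap sig_big_dep.
Qed.

End LinearSpan.

(** Termwise: a binomial coefficient grows with its upper argument, and truncated subtraction is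
    monotone. *)
Lemma nmonom_upto_homo (l n p : nat) :
  (l <= n)%N -> (nmonom_upto l p <= nmonom_upto n p)%N.
Proof.
move=> ln; apply: leq_sum => k _; apply: leq_bin2l.
by rewrite leq_sub2r// leq_add2r.
Qed.

Lemma sup_nneg_le_image (R : realType) (T : Type) (S : set T)
    (f g : T -> \bar R) :
  (forall s, S s -> (f s <= g s)%E) ->
  (sup_nneg [set f s | s in S] <= sup_nneg [set g s | s in S])%E.
Proof.
(* The floor [0] is common to both sides, which leaves only the two suprema to compare. *)
move=> fg; rewrite /sup_nneg ge_max le_max lexx /=.
rewrite le_max; apply/orP; right; apply: ge_ereal_sup => _ [s Ss <-].
by apply: le_ereal_sup_tmp; exists (g s); [exists s|exact: fg].
Qed.

Section WidthBounds.
Context {R : realType} {kind : scalar_kind}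
  {V : normedModType (scalars R kind)}.
Local Notation K := (scalars R kind).

Lemma dist_subset (S M U : set V) : M `<=` U -> (dist S U <= dist S M)%E.
Proof.
move=> MU; apply: sup_nneg_le_image => s _.
by apply: ereal_inf_le_tmp => _ [t Mt <-]; exists t => //; exact: MU.
Qed.

Lemma dist_range_le_encoding_error (l : nat) (S : set V) (G : 'rV[K]_l -> V)
    (e : V -> 'rV[K]_l) :
  (dist S (range G) <= encoding_error S G e)%E.
Proof.
apply: sup_nneg_le_image => s _.
by apply: ereal_inf_lbound; exists (G (e s)) => //; exists (e s).
Qed.

Lemma kolmogorov_width_le_poly (S : set V) (n p : nat) :
  (kolmogorov_width (nmonom_upto n p) S <= poly_kolmogorov_width n p S)%E.
Proof.
apply: le_ereal_inf_tmp => _ [M [l /andP[_ ln] /submanifold_sub_subspace] + <-].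
move=> [U [Ulin Udim MU]].
apply: (le_trans _ (dist_subset S MU)); apply: ereal_inf_lbound; exists U => //.
by split=> //; exact: dim_leW (nmonom_upto_homo p ln) Udim.
Qed.

Lemma poly_kolmogorov_width_le_manifold (S : set V) (n p : nat) :
  (poly_kolmogorov_width n p S <= poly_manifold_width n p S)%E.
Proof.
apply: le_ereal_inf_tmp => _ [l [ln [G Gpoly ->]]].
(* The manifold width is a nested infimum, so it suffices to bound the error of each pair of a
   mapping and an encoder. *)
apply: le_ereal_inf_tmp => _ [e _ <-].
apply: (le_trans _ (dist_range_le_encoding_error S G e)).
by apply: ereal_inf_lbound; exists (range G) => //; exists l => //; exists G.
Qed.

End WidthBounds.

Theorem theorem2 (R : realType) (kind : scalar_kind)
    (V : normedModType (scalars R kind)) (S : set V) (n p : nat) (hn : (0 < n)%N) :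
  (kolmogorov_width (nmonom_upto n p) S <= poly_kolmogorov_width n p S
     <= poly_manifold_width n p S)%E.
Proof.
by rewrite kolmogorov_width_le_poly poly_kolmogorov_width_le_manifold.
Qed.
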